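(* Let $(A,B_1,\ldots,B_p)$ satisfy conditions (i)–(ii) of the context and let $k$ be a positive integer. Assume that for every $u\in\mathbf{R}^p$, $D(|A|^{k/2})=D(|A+\sum_l u_lB_l|^{k/2})$, and that for every $l=1,\ldots,p$ the restriction of $B_l$ to $D(|A|^{k/2})$ is bounded for the $k/2$-norm (i.e. $B_l$ maps $D(|A|^{k/2})$ into itself and there is a constant $C_{l,k}$ with $\|B_l\psi\|_{k/2}\le C_{l,k}\|\psi\|_{k/2}$ for all $\psi\in D(|A|^{k/2})$). Then $(A,B_1,\ldots,B_p)$ is $k$-weakly-coupled.
   Context: $H$ is a separable complex Hilbert space with norm $\|\cdot\|$ and inner product $\langle\cdot,\cdot\rangle$; $\mathbf{N}=\{1,2,\ldots\}$. $(A,B_1,\ldots,B_p)$ is a $(p+1)$-tuple of linear operators in $H$. Conditions: (i) for every $u\in\mathbf{R}^p$, $A+\sum_l u_lB_l$ is essentially skew-adjoint on the domain $D(A)$ of $A$, and $\mathrm{i}(A+\sum_l u_lB_l)$ is bounded from below; (ii) $A$ is skew-adjoint with purely discrete spectrum $(-\mathrm{i}\lambda_j)_{j\in\mathbf{N}}$, where $(\lambda_j)_{j\in\mathbf{N}}$ is positive, non-decreasing and unbounded. $(\phi_j)_{j\in\mathbf{N}}$ is a Hilbert basis of $H$ with $A\phi_j=-\mathrm{i}\lambda_j\phi_j$. $A+\sum_l u_lB_l$ also denotes its skew-adjoint closure, and $D(A+\sum_l u_lB_l)$ is the domain on which it is skew-adjoint. For $s\ge 0$, $D(|A|^s)=\{\psi\in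 H:\sum_j\lambda_j^{2s}|\langle\phi_j,\psi\rangle|^2<\infty\}$, $|A|^s\psi=\sum_j\lambda_j^s\langle\phi_j,\psi\rangle\phi_j$, and the $s$-norm is $\|\psi\|_s=\||A|^s\psi\|$. Powers of the modulus of other skew-adjoint operators are defined likewise by functional calculus. For $k>0$, $(A,B_1,\ldots,B_p)$ (satisfying (i)) is $k$-weakly-coupled if for every $u\in\mathbf{R}^p$, $D(|A+\sum_l u_lB_l|^{k/2})=D(|A|^{k/2})$, and there is a constant $C$ such that for every $1\le l\le p$ and $\psi\in D(|A|^k)$, $|\Re\langle|A|^k\psi,B_l\psi\rangle|\le C|\langle|A|^k\psi,\psi\rangle|$. *)

(* Defs.v *)
From HB Require Import structures.
From mathcomp Require Import all_boot all_order all_algebra.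
From mathcomp Require Import all_classical all_reals all_analysis.
From mathcomp Require Import complex.

Set Implicit Arguments.
Unset Strict Implicit.
Unset Printing Implicit Defensive.

Import Order.TTheory GRing.Theory Num.Theory.
Import numFieldNormedType.Exports.

Local Open Scope classical_set_scope.
Local Open Scope ring_scope.

(* A complex Hilbert space is a [completeNormedModType R[i]] whose norm is the
   one induced by the form [dot].  Forms of type [{dot H for Num.conj}] are
   linear in their FIRST argument, whereas <x, y> below is linear in y. *)
Section hilbert.
Context {R : realType} {H : completeNormedModType R[i]}.

Definition induces_norm (dot : {dot H for Num.conj}) :=
  forall x : H, dot x x = `|x| ^+ 2.

Definition inner (dot : {dot H for Num.conj}) (x y : H) : R[i] := dot y x.

(* The norm of [H] is valued in [R[i]]; [hnorm] is the same number in [R]. *)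
Definition hnorm (x : H) : R := complex.Re `|x|.

Definition separable := exists S : set H, countable S /\ dense S.

Definition lin_span (e : nat -> H) : set H :=
  [set x | exists n (c : nat -> R[i]), x = \sum_(i < n) c i *: e i].

Definition hilbert_basis (dot : {dot H for Num.conj}) (e : nat -> H) :=
  (forall i j, inner dot (e i) (e j) = (i == j)%:R) /\ dense (lin_span e).

(* The value of [op] outside [dom] carries no meaning. *)
Record lin_operator := LinOperator {
  dom : set H;
  op :> H -> H;
  dom0 : dom 0;
  domP : forall (a : R[i]) x y, dom x -> dom y -> dom (a *: x + y);
  opP : forall (a : R[i]) x y, dom x -> dom y ->
          op (a *: x + y) = a *: op x + op y }.

End hilbert.
Arguments lin_operator {R} H.
Arguments separable {R} H.

(* Operators up to the choice of junk values, and their closures, are handled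
   through their graphs. *)
Section graphs.
Context {R : realType} {H : completeNormedModType R[i]}.
Variable dot : {dot H for Num.conj}.
Local Notation "<< x , y >>" := (inner dot x y).
Implicit Types (G : set (H * H)) (A : lin_operator H).

Definition graph A : set (H * H) := [set xy | dom A xy.1 /\ xy.2 = A xy.1].

Definition gdom G : set H := [set x | exists y, G (x, y)].

Definition gopp G : set (H * H) := [set xy | G (xy.1, - xy.2)].

Definition adjoint G : set (H * H) :=
  [set xy | forall z w, G (z, w) -> << w, xy.1 >> = << z, xy.2 >>].

Definition skew_adjoint G := dense (gdom G) /\ adjoint G = gopp G.

Definition essentially_skew_adjoint G := skew_adjoint (closure G).

(* The order of [R[i]] makes this inequality assert that <x, i T x> is real. *)
Definition i_bounded_below G := exists c : R, forall x y, G (x, y) ->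
  (c%:C * `|x| ^+ 2 <= << x, 'i *: y >>)%C.

Definition eigenvector A (z : R[i]) (x : H) := dom A x /\ A x = z *: x.

Definition resolvent_set A : set R[i] := [set z | exists S : H -> H,
  [/\ forall y, dom A (S y) /\ A (S y) - z *: S y = y,
      forall x, dom A x -> S (A x - z *: x) = x &
      exists M : R, forall y, hnorm (S y) <= M * hnorm y]].

Definition spectrum A : set R[i] := ~` resolvent_set A.

Definition purely_discrete_spectrum A := forall z, spectrum A z ->
  [/\ exists2 r : R, 0 < r & forall w, spectrum A w -> `|w - z| < r%:C%C -> w = z,
      exists2 x, x != 0 & eigenvector A z x &
      exists n (e : 'I_n -> H), forall x, eigenvector A z x ->
        exists c : 'I_n -> R[i], x = \sum_i c i *: e i].

(* Projection-valued measures on the Borel sets of R. *)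
Record projection_valued_measure (E : set R -> H -> H) : Prop := {
  pvm_linear : forall X, measurable X -> linear (E X);
  pvm_idem : forall X, measurable X -> forall x, E X (E X x) = E X x;
  pvm_selfadjoint : forall X, measurable X ->
    forall x y, << E X x, y >> = << x, E X y >>;
  pvm_setT : forall x, E setT x = x;
  pvm_sigma_additive : forall F : (set R)^nat,
    (forall n, measurable (F n)) -> trivIset setT F ->
    forall x, series (fun n => E (F n) x) @ \oo --> E (\bigcup_n F n) x }.

Definition spectral_measure_at (E : set R -> H -> H) (x : H) : set R -> \bar R :=
  fun X => (complex.Re << x, E X x >>)%:E.

(* Domain of the operator \int f dE, for real-valued f. *)
Definition functional_calculus_dom (E : set R -> H -> H) (f : R -> R) : set H :=
  [set x | (\int[spectral_measure_at E x]_t (f t ^+ 2)%:E < +oo)%E].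

(* T = \int i t dE(t) for the operator T with graph G.  By polarization, the
   domain and the quadratic form determine the operator. *)
Definition spectral_resolution (E : set R -> H -> H) G :=
  [/\ projection_valued_measure E,
      gdom G = functional_calculus_dom E idfun &
      forall x y, G (x, y) ->
        << x, y >> =
        ('i * (fine (\int[spectral_measure_at E x]_t t%:E))%:C)%C].

(* D(|T|^s) for a skew-adjoint T with graph G; by the spectral theorem such an
   E exists and is unique on Borel sets. *)
Definition abs_power_dom G (s : R) : set H :=
  [set x | exists2 E, spectral_resolution E G &
           functional_calculus_dom E (fun t => `|t| `^ s) x].

End graphs.

(* Powers of |A| for A diagonalized in the Hilbert basis [phi], with
   A phi_j = - i lam_j phi_j.  All sequences are indexed from 0. *)
Section diagonal.
Context {R : realType} {H : completeNormedModType R[i]}.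
Variables (dot : {dot H for Num.conj}) (lam : nat -> R) (phi : nat -> H).
Local Notation "<< x , y >>" := (inner dot x y).

Definition Dpow (s : R) : set H :=
  [set x | (\sum_(0 <= j <oo)
     (lam j `^ (2 * s) * complex.Re (`|<< phi j, x >>| ^+ 2))%:E < +oo)%E].

(* Meaningful only for [x] in [Dpow s], where the series converges. *)
Definition Apow (s : R) (x : H) : H :=
  limn (series (fun j => (lam j `^ s)%:C%C *: (<< phi j, x >> *: phi j))).

Definition snorm (s : R) (x : H) : R := hnorm (Apow s x).

Definition bounded_for_snorm (s : R) (B : lin_operator H) :=
  (forall x, Dpow s x -> dom B x /\ Dpow s (B x)) /\
  exists C : R, forall x, Dpow s x -> snorm s (B x) <= C * snorm s x.

End diagonal.

Section control.
Context {R : realType} {H : completeNormedModType R[i]}.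
Variable dot : {dot H for Num.conj}.
Variables (p : nat) (A : lin_operator H) (B : 'I_p -> lin_operator H).
Local Notation "<< x , y >>" := (inner dot x y).

(* A + \sum_l u_l B_l with domain D(A). *)
Definition perturbed (u : 'I_p -> R) : set (H * H) :=
  [set xy | dom A xy.1 /\ xy.2 = A xy.1 + \sum_l (u l)%:C%C *: B l xy.1].

Definition condition_i :=
  (forall l, dom A `<=` dom (B l)) /\
  forall u, essentially_skew_adjoint dot (perturbed u) /\
            i_bounded_below dot (perturbed u).

Definition condition_ii (lam : nat -> R) (phi : nat -> H) :=
  [/\ skew_adjoint dot (graph A),
      purely_discrete_spectrum A /\
        spectrum A = range (fun j => - ('i * (lam j)%:C)%C),
      [/\ forall j, 0 < lam j, nondecreasing_seq lam &
          forall M : R, exists j, M < lam j],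
      hilbert_basis dot phi &
      forall j, eigenvector A (- ('i * (lam j)%:C)%C) (phi j)].

Definition same_power_domain lam phi (s : R) := forall u : 'I_p -> R,
  abs_power_dom dot (closure (perturbed u)) s = Dpow dot lam phi s.

(* For k > 0 and (A, B) satisfying [condition_i].  Membership in [dom (B l)] is
   what makes [B l x] meaningful. *)
Definition weakly_coupled lam phi (k : R) :=
  same_power_domain lam phi (k / 2) /\
  exists C : R, forall l x, Dpow dot lam phi k x ->
    dom (B l) x /\
    `|complex.Re << Apow dot lam phi k x, B l x >>|
      <= C * complex.Re `|<< Apow dot lam phi k x, x >>|.

End control.

(* Main.v *)
Require Import Defs.
From HB Require Import structures.
From mathcomp Require Import all_boot all_order all_algebra.
From mathcomp Require Import all_classical all_reals all_analysis.
From mathcomp Require Import complex.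
From mathcomp Require Import ring.

Import Order.TTheory GRing.Theory Num.Theory.
Import numFieldNormedType.Exports.
Local Open Scope classical_set_scope.
Local Open Scope ring_scope.

(** Write [|A|^s] for [Apow], given by the weights [lam j `^ s] on the basis
    [phi].  Because it is diagonal with real weights, it is symmetric and its
    exponents add up, so that half of the power k can be moved across the inner
    product:
      << |A|^k x, y >> = << |A|^(k/2) x, |A|^(k/2) y >>
    for x in D(|A|^k) and y in D(|A|^(k/2)) ([inner_Apow]).  Take y = B_l x,
    which lies in D(|A|^(k/2)) because x does ([Dpow_sub]) and B_l preserves
    that domain.  The Cauchy-Schwarz inequality and the bound on B_l give
      |Re << |A|^k x, B_l x >>| <= ||x||_(k/2) ||B_l x||_(k/2)
                                <= C_l ||x||_(k/2) ^ 2,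
    while the same identity at y = x reads
      << |A|^k x, x >> = ||x||_(k/2) ^ 2.
    The sum of the |C_l| therefore serves as a constant common to all l.

    The analytic content is the identity.  It holds for partial sums by
    orthonormality; it passes to the limit because the series that define the
    powers converge on their domains ([cvg_Apow], which rests on the
    Riesz-Fischer argument of [cvg_orthonormal_series]) and because the inner
    product is continuous ([cvg_inner]). *)

Lemma Re_sqr_normr (R : realType) (z : R[i]) :
  (complex.Re (`|z| ^+ 2))%:C%C = `|z| ^+ 2.
Proof. by rewrite RRe_real // realX // normr_real. Qed.

Section hilbert_facts.
Context {R : realType} {H : completeNormedModType R[i]}.
Variable dot : {dot H for Num.conj}.
Hypothesis Hdot : induces_norm dot.
Local Notation "<< x , y >>" := (inner dot x y).

Lemma inner_conj x y : << y, x >> = (<< x, y >>)^*.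
Proof. by rewrite /inner [LHS]hermC expr0 mul1r. Qed.

Lemma inner_self x : << x, x >> = `|x| ^+ 2.
Proof. exact: Hdot. Qed.

Lemma innerZl a x y : << a *: x, y >> = a^* * << x, y >>.
Proof. by rewrite /inner linearZr_LR. Qed.

Lemma innerZr a x y : << x, a *: y >> = a * << x, y >>.
Proof. by rewrite /inner linearZl_LR. Qed.

Lemma innerDl x y z : << x + y, z >> = << x, z >> + << y, z >>.
Proof. by rewrite /inner linearDr. Qed.

Lemma innerDr x y z : << z, x + y >> = << z, x >> + << z, y >>.
Proof. by rewrite /inner linearDl. Qed.

Lemma inner_suml I (r : seq I) (P : pred I) (F : I -> H) x :
  << \sum_(i <- r | P i) F i, x >> = \sum_(i <- r | P i) << F i, x >>.
Proof. by rewrite /inner linear_sumr. Qed.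

Lemma inner_sumr I (r : seq I) (P : pred I) (F : I -> H) x :
  << x, \sum_(i <- r | P i) F i >> = \sum_(i <- r | P i) << x, F i >>.
Proof. by rewrite /inner linear_sumlz. Qed.

(** Expressing the form by norms alone makes its joint continuity a consequence
    of the continuity of the norm.  The minus sign before ['i] reflects
    antilinearity in the first argument. *)
Lemma inner_polarization x y : << x, y >> =
  (`|x + y| ^+ 2 - `|x + (-1 : R[i]) *: y| ^+ 2
   - 'i * (`|x + 'i *: y| ^+ 2 - `|x + (- 'i : R[i]) *: y| ^+ 2)) / 4.
Proof.
rewrite -!inner_self !(innerDl, innerDr, innerZl, innerZr).
rewrite !rmorphN rmorph1 /= conjCi.
have i2 : 'i * 'i = -1 :> R[i] by rewrite -expr2 sqrCi.
have n4 : (4 : R[i]) != 0 by rewrite pnatr_eq0.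
apply: (canRL (mulfK n4)).
(* Over abstract letters [ring] does not have to see through the several
   structures that [R[i]] and ['i] carry in the goal. *)
suff alg : forall I a b c d : R[i], I * I = -1 -> c * 4 =
    a + c + (d + b) - (a + -1 * c + (-1 * d + -1 * (-1 * b))) -
    I * (a + I * c + (- I * d + - I * (I * b)) -
         (a + - I * c + (- - I * d + - - I * (- I * b)))) by exact: alg.
by move=> I a b c d I2; ring: I2.
Qed.

Lemma cvg_inner (u v : nat -> H) x y :
  u @ \oo --> x -> v @ \oo --> y ->
  (fun n => << u n, v n >> : R[i]^o) @ \oo --> (<< x, y >> : R[i]^o).
Proof.
move=> ux vy; rewrite inner_polarization.
under eq_fun do rewrite inner_polarization.
have N2 a : (fun n => `|u n + a *: v n| ^+ 2 : R[i]^o) @ \oo -->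
            (`|x + a *: y| ^+ 2 : R[i]^o).
  have nD : (fun n => `|u n + a *: v n| : R[i]^o) @ \oo -->
            (`|x + a *: y| : R[i]^o).
    by apply: cvg_norm; apply: cvgD => //; exact: cvgZr.
  by rewrite expr2; under eq_fun do rewrite expr2; exact: cvgM.
apply: cvgM; last exact: cvg_cst.
apply: cvgB; last by apply: cvgM; [exact: cvg_cst | apply: cvgB; exact: N2].
apply: cvgB; last exact: N2.
by have := N2 1; under eq_fun do rewrite scale1r; rewrite scale1r.
Qed.

(** Cauchy-Schwarz: the vector [`|x| ^+ 2 *: y - << x, y >> *: x], which is
    [`|x| ^+ 2] times the component of [y] orthogonal to [x], has nonnegative
    square norm. *)
Lemma normr_inner_le x y : `|<< x, y >>| <= `|x| * `|y|.
Proof.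
have [->|x0] := eqVneq x 0.
  by rewrite /inner linear0r !normr0 mul0r.
rewrite -(@ler_pXn2r _ 2) ?nnegrE ?mulr_ge0// exprMn.
have x2 : 0 < `|x| ^+ 2 by rewrite exprn_gt0 // normr_gt0.
have : 0 <= << `|x| ^+ 2 *: y + (- << x, y >>) *: x,
               `|x| ^+ 2 *: y + (- << x, y >>) *: x >>.
  by rewrite inner_self exprn_ge0.
rewrite !(innerDl, innerDr, innerZl, innerZr) !inner_self (inner_conj x y).
rewrite rmorphN (conj_Creal (ger0_real (ltW x2))).
rewrite normCK.
set a := `|x| ^+ 2; set b := `|y| ^+ 2; set c := << x, y >>; set d := c^*.
rewrite (_ : _ + _ = a * (a * b - c * d)); last by ring.
by rewrite pmulr_rge0 // subr_ge0.
Qed.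

Lemma hnormE (x : H) : (hnorm x)%:C%C = `|x|.
Proof. by rewrite /hnorm RRe_real ?normr_real. Qed.

Lemma hnorm_ge0 (x : H) : 0 <= hnorm x.
Proof. by rewrite -ler0c hnormE. Qed.

Lemma Re_normr_inner_self x : complex.Re `|<< x, x >>| = hnorm x ^+ 2.
Proof.
by rewrite inner_self normrX normr_id -hnormE -rmorphXn.
Qed.

Lemma Re_inner_le x y : `|complex.Re << x, y >>| <= hnorm x * hnorm y.
Proof.
rewrite -lecR rmorphM /= !hnormE.
exact: le_trans (normc_ge_Re _) (normr_inner_le x y).
Qed.

Section orthonormal_series.
Variable e : nat -> H.
Hypothesis e_on : forall i j, << e i, e j >> = (i == j)%:R.

Lemma inner_orthonormal_sum (a b : nat -> R[i]) m n :
  << \sum_(m <= i < n) a i *: e i, \sum_(m <= i < n) b i *: e i >> =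
  \sum_(m <= i < n) (a i)^* * b i.
Proof.
rewrite inner_suml; apply: eq_big_nat => i imn.
rewrite innerZl inner_sumr (bigD1_seq i) ?iota_uniq //=; last first.
  by rewrite mem_index_iota.
rewrite innerZr e_on eqxx mulr1 big1 ?addr0 // => j ji.
by rewrite innerZr e_on eq_sym (negPf ji) mulr0.
Qed.

(** Riesz-Fischer: by Pythagoras the squared norm of a block of the series is
    the corresponding block of the series of squared moduli, so the partial sums
    are Cauchy; they converge because [H] is complete. *)
Lemma cvg_orthonormal_series (c : nat -> R[i]) :
  (\sum_(0 <= j <oo) (complex.Re (`|c j| ^+ 2))%:E < +oo)%E ->
  cvgn (series (fun j => c j *: e j)).
Proof.
move=> /nnseries_is_cvg csum; apply/cauchy_cvgP/cauchy_seriesP => eps eps0.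
have epsE : (complex.Re eps)%:C%C = eps by rewrite RRe_real // gtr0_real.
have r0 : 0 < complex.Re eps by rewrite -ltcR epsE.
have c_ge0 j : 0 <= complex.Re (`|c j| ^+ 2).
  by rewrite -ler0c Re_sqr_normr exprn_ge0.
have /cauchy_cvgP/cauchy_seriesP := csum c_ge0.
(* Blocks of the scalar series are squares of norms: the tolerance is squared. *)
move=> /(_ _ (exprn_gt0 2 r0)); apply: filterS => -[m n] /=.
rewrite ger0_norm; last by apply: sumr_ge0 => j _; exact: c_ge0.
move=> lt_mn.
have lt2 : `|\sum_(m <= j < n) c j *: e j| ^+ 2 < eps ^+ 2.
  rewrite -inner_self inner_orthonormal_sum -epsE -rmorphXn.
  have -> : \sum_(m <= j < n) (c j)^* * c j =
            (\sum_(m <= j < n) complex.Re (`|c j| ^+ 2))%:C%C.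
    by rewrite rmorph_sum; apply: eq_bigr => j _; rewrite [RHS]Re_sqr_normr normCKC.
  by rewrite ltcR.
by move: lt2; rewrite ltr_pXn2r ?nnegrE // ltW.
Qed.

Section powers.
Variable lam : nat -> R.
Hypothesis lam_gt0 : forall j, 0 < lam j.

Let lam_powD j r s : lam j `^ (r + s) = lam j `^ r * lam j `^ s.
Proof. by rewrite powRD // (gt_eqF (lam_gt0 j)) implybT. Qed.

(** [Apow] is a [limn], which means nothing by itself when the series diverges;
    membership in [Dpow] is exactly the square summability of its
    coefficients. *)
Lemma cvg_Apow s x : Dpow dot lam e s x ->
  series (fun j => (lam j `^ s)%:C%C *: (<< e j, x >> *: e j)) @ \oo -->
  Apow dot lam e s x.
Proof.
move=> xs; rewrite /Apow; under eq_fun do rewrite scalerA.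
apply: cvg_orthonormal_series; move: xs; congr (_ < _)%E.
apply: eq_eseriesr => j _; congr (_%:E); apply: complexI.
rewrite rmorphM /= !Re_sqr_normr normrM exprMn; congr (_ * _).
rewrite ger0_norm ?ler0c ?powR_ge0 // -rmorphXn /=.
by rewrite mulrDl mul1r lam_powD expr2.
Qed.

(** The weights may be smaller than 1, so the comparison of [lam j `^ (2 * r)]
    with [lam j `^ (2 * s)] costs a constant, which the least weight [lam 0]
    provides: [2 * (r - s)] is nonpositive. *)
Lemma Dpow_sub s r : nondecreasing_seq lam -> r <= s ->
  Dpow dot lam e s `<=` Dpow dot lam e r.
Proof.
move=> lam_nd rs x; pose a j := complex.Re (`|<< e j, x >>| ^+ 2).
have a_ge0 j : 0 <= a j by rewrite /a -ler0c Re_sqr_normr exprn_ge0.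
move=> xs; rewrite /Dpow; pose M := lam 0%N `^ (2 * (r - s)).
have : (\sum_(0 <= j <oo) (M%:E * (lam j `^ (2 * s) * a j)%:E) < +oo)%E.
  rewrite nneseriesZl ?lte_mul_pinfty ?lee_fin ?powR_ge0 // => j _.
  by rewrite lee_fin mulr_ge0 ?powR_ge0.
apply: le_lt_trans; apply: lee_nneseries => [j _ _|j _].
  by rewrite lee_fin mulr_ge0 ?powR_ge0 ?a_ge0.
rewrite -EFinM lee_fin mulrA; apply: ler_wpM2r; first exact: a_ge0.
have -> : 2 * r = 2 * (r - s) + 2 * s by ring.
rewrite lam_powD ler_wpM2r ?powR_ge0 // /M.
rewrite -opprB mulrN !powRN lef_pV2 ?posrE ?powR_gt0 //.
apply: ge0_ler_powR; rewrite ?nnegrE ?(ltW (lam_gt0 _)) //.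
  by rewrite mulr_ge0 // subr_ge0.
exact: lam_nd.
Qed.

(** A real diagonal operator is symmetric and [lam j `^ (r + s)] factors, so the
    identity holds between partial sums; the orthonormality of [e] kills the
    cross terms on the right.  Both sides are then limits of the same sequence. *)
Lemma inner_Apow r s x y :
  Dpow dot lam e (r + s) x -> Dpow dot lam e r x -> Dpow dot lam e s y ->
  << Apow dot lam e (r + s) x, y >> =
  << Apow dot lam e r x, Apow dot lam e s y >>.
Proof.
move=> /cvg_Apow xrs /cvg_Apow xr /cvg_Apow ys.
pose S t z := series (fun j => (lam j `^ t)%:C%C *: (<< e j, z >> *: e j)).
have partial_sums n : << S (r + s) x n, y >> = << S r x n, S s y n >>.
  rewrite /S /series /=.
  under [in RHS]eq_bigr do rewrite scalerA.
  under [X in _ = << _, X >>]eq_bigr do rewrite scalerA.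
  rewrite inner_orthonormal_sum inner_suml; apply: eq_bigr => j _.
  rewrite !innerZl lam_powD !rmorphM /=.
  by rewrite [X in _ * X * _]conj_Creal ?complex_real // mulrACA.
have lhs : (fun n => << S r x n, S s y n >> : R[i]^o) @ \oo -->
           (<< Apow dot lam e (r + s) x, y >> : R[i]^o).
  by under eq_fun do rewrite -partial_sums; apply: cvg_inner (cvg_cst y).
have rhs := cvg_inner _ _ _ _ xr ys.
exact: (@cvg_unique _ (@norm_hausdorff _ R[i]^o) _ _ _ _ lhs rhs).
Qed.

End powers.
End orthonormal_series.
End hilbert_facts.

Theorem proposition6
  (R : realType) (H : completeNormedModType R[i]) (dot : {dot H for Num.conj})
  (Hdot : induces_norm dot) (Hsep : separable H)
  (p : nat) (A : lin_operator H) (B : 'I_p -> lin_operator H)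
  (lam : nat -> R) (phi : nat -> H)
  (Hi : condition_i dot A B) (Hii : condition_ii dot A lam phi)
  (k : nat) (k_gt0 : (0 < k)%N)
  (Hdom : same_power_domain dot A B lam phi (k%:R / 2))
  (HB : forall l : 'I_p, bounded_for_snorm dot lam phi (k%:R / 2) (B l)) :
  weakly_coupled dot A B lam phi k%:R.
Proof.
split=> //.
have [_ _ [lam_gt0 lam_nd _] [phi_on _] _] := Hii.
have /choice[c cP] : forall l, exists C : R, forall x,
    Dpow dot lam phi (k%:R / 2) x ->
    snorm dot lam phi (k%:R / 2) (B l x) <= C * snorm dot lam phi (k%:R / 2) x.
  by move=> l; have [] := HB l.
exists (\sum_l `|c l|) => l x xk.
have k2 : k%:R / 2 <= k%:R :> R.
  by rewrite ler_pdivrMr // ler_peMr ?ler0n // ler1n.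
have xk2 : Dpow dot lam phi (k%:R / 2) x by apply: Dpow_sub xk.
have [Bdom Bxk2] := (HB l).1 x xk2; split=> //.
have form y : Dpow dot lam phi (k%:R / 2) y ->
    inner dot (Apow dot lam phi k%:R x) y =
    inner dot (Apow dot lam phi (k%:R / 2) x) (Apow dot lam phi (k%:R / 2) y).
  by move=> yk2; rewrite {1}(splitr k%:R); apply: inner_Apow; rewrite -?splitr.
rewrite (form _ Bxk2) (form _ xk2) Re_normr_inner_self //.
apply: le_trans (Re_inner_le _ Hdot _ _) _.
rewrite expr2 mulrCA ler_wpM2l ?hnorm_ge0 //.
apply: le_trans (cP l x xk2) _; rewrite ler_wpM2r ?hnorm_ge0 //.
apply: le_trans (ler_norm _) _.
by rewrite (bigD1 l) //= lerDl sumr_ge0.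
Qed.
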